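(* Let $N \ge 2$ and let $\mathbf{B} \in \mathbb{R}^{N\times N}$ be the symmetric tridiagonal matrix, with rows and columns indexed by $0,\ldots,N-1$, whose diagonal is $(-1,-2,-2,\ldots,-2,-1)$ (first and last diagonal entries $-1$, all other diagonal entries $-2$), whose entries at positions $(j,k)$ with $|j-k|=1$ are $1$, and whose other entries are $0$. Then the Moore-Penrose inverse of $\mathbf{L} = -\mathbf{B}^2$ is a symmetric matrix $\mathbf{L}^+ = -(\mathbf{B}^2)^+ = (d_{j,k}^+)_{j,k=0}^{N-1}$ with $$d_{j,k}^+ = -\frac{(N^2-1)(4N^2-1)}{180N} + \frac{[j(j+1)+k(k+1)]^2}{24N} + \frac{j(j+1)k(k+1)}{6N} + \frac{N}{6}\,[j(j+1)+k(k+1)] - \frac{2j+1}{12}\,[j(j+1)+3k(k+1)]$$ for $j \ge k$.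
   Context: The Moore-Penrose inverse of a real square matrix $\mathbf{L}$ is the unique matrix $\mathbf{L}^+$ such that $\mathbf{L}\mathbf{L}^+\mathbf{L} = \mathbf{L}$, $\mathbf{L}^+\mathbf{L}\mathbf{L}^+ = \mathbf{L}^+$, and both $\mathbf{L}\mathbf{L}^+$ and $\mathbf{L}^+\mathbf{L}$ are symmetric. *)

(* Defs.v *)
From mathcomp Require Import all_boot all_order all_algebra.
From mathcomp Require Import reals.

Set Implicit Arguments.
Unset Strict Implicit.
Unset Printing Implicit Defensive.

Import Order.TTheory GRing.Theory Num.Theory.
Local Open Scope ring_scope.

Section MoorePenrose.
Variable R : realFieldType.

Definition penrose n (A P : 'M[R]_n) : bool :=
  [&& A *m P *m A == A, P *m A *m P == P,
      (A *m P)^T == A *m P & (P *m A)^T == P *m A].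

Lemma row_free_gram_unit m n (F : 'M[R]_(m, n)) :
  row_free F -> F *m F^T \in unitmx.
Proof.
move=> freeF; rewrite -row_free_unit -kermx_eq0; apply/eqP/row_matrixP => i.
rewrite row0; set v := row i _.
have v0 : v *m F *m F^T = 0.
  by rewrite -mulmxA; apply/sub_kermxP; exact: row_sub.
have: v *m F *m (v *m F)^T = 0 by rewrite trmx_mul mulmxA v0 mul0mx.
move/matrixP/(_ 0 0); rewrite !mxE.
under eq_bigr => j _ do rewrite [X in _ * X]mxE -expr2.
move/eqP; rewrite psumr_eq0; last by move=> j _; exact: sqr_ge0.
move=> /allP sq0; apply: (row_free_inj freeF); rewrite mul0mx.
apply/matrixP => a j; rewrite (ord1 a) [RHS]mxE; apply/eqP.
by have := sq0 j (mem_index_enum j); rewrite sqrf_eq0.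
Qed.

Lemma penrose_exists n (A : 'M[R]_n) : exists P, penrose A P.
Proof.
have [r [C [F [AE freeF freeC]]]] : exists r (C : 'M_(n, r)) (F : 'M_(r, n)),
    [/\ A = C *m F, row_free F & row_free C^T].
  exists (\rank A), (col_base A), (row_base A); split.
  - by rewrite mulmx_base.
  - exact: row_base_free.
  - by rewrite /row_free mxrank_tr; exact: col_base_full.
pose GF := F *m F^T; pose GC := C^T *m C.
have uF : GF \in unitmx by exact: row_free_gram_unit.
have uC : GC \in unitmx.
  by rewrite /GC -{2}[C]trmxK; exact: row_free_gram_unit.
have sF : (invmx GF)^T = invmx GF by rewrite trmx_inv trmx_mul trmxK.
have sC : (invmx GC)^T = invmx GC by rewrite trmx_inv trmx_mul trmxK.
pose P := F^T *m invmx GF *m invmx GC *m C^T.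
have AP : A *m P = C *m invmx GC *m C^T.
  by rewrite AE /P !mulmxA -(mulmxA C F) -/GF mulmxK.
have PA : P *m A = F^T *m invmx GF *m F.
  by rewrite AE /P !mulmxA -(mulmxA _ C^T C) -/GC mulmxKV.
exists P; apply/and4P; split; apply/eqP.
- by rewrite AP {1}AE mulmxA -(mulmxA _ C^T C) -/GC mulmxKV // -AE.
- by rewrite PA /P !mulmxA -(mulmxA _ F F^T) -/GF mulmxKV.
- by rewrite AP !trmx_mul trmxK sC mulmxA.
- by rewrite PA !trmx_mul trmxK sF mulmxA.
Qed.

Lemma penrose_unique n (A P Q : 'M[R]_n) :
  penrose A P -> penrose A Q -> P = Q.
Proof.
move=> /and4P[/eqP APA /eqP PAP /eqP sAP /eqP sPA].
move=> /and4P[/eqP AQA /eqP QAQ /eqP sAQ /eqP sQA].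
have eAP : A *m P = A *m Q.
  rewrite -sAP -[in LHS]AQA -(mulmxA (A *m Q) A P).
  by rewrite trmx_mul sAP sAQ mulmxA APA.
have ePA : P *m A = Q *m A.
  rewrite -sPA -[in LHS]AQA -(mulmxA A Q A) mulmxA.
  by rewrite trmx_mul sPA sQA -mulmxA (mulmxA A P A) APA.
by rewrite -PAP ePA -mulmxA eAP mulmxA QAQ.
Qed.

Definition moore_penrose n (A : 'M[R]_n) : 'M[R]_n :=
  xchoose (penrose_exists A).

Lemma moore_penroseP n (A : 'M[R]_n) : penrose A (moore_penrose A).
Proof. exact: xchooseP. Qed.

Lemma moore_penrose_unique n (A P : 'M[R]_n) :
  penrose A P -> moore_penrose A = P.
Proof. exact/penrose_unique/moore_penroseP. Qed.

End MoorePenrose.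

Definition tridiag (R : realFieldType) (N : nat) : 'M[R]_N :=
  \matrix_(j < N, k < N)
    if j == k then
      if (j == 0 :> nat) || (j == N.-1 :> nat) then -1 else - 2%:R
    else if (j == k.+1 :> nat) || (k == j.+1 :> nat) then 1
    else 0.

(* Main.v *)
Require Import Defs.
From mathcomp Require Import all_boot all_order all_algebra.
From mathcomp Require Import reals.
From mathcomp Require Import zify ring.

(** Let [P] be the claimed matrix and [J] the matrix with all entries [1/N].
    As [B] is minus the Laplacian of a path with reflecting ends, two second
    differences give [B P = G] and [B G = J - I] for an explicit Green kernel
    [G], so [L P = I - J].  Since [L J = 0], and since [J P = 0] because the
    columns of [P] sum to zero, the symmetric matrix [P] satisfies the Penrose
    equations. *)

Import Order.TTheory GRing.Theory Num.Theory.
Local Open Scope ring_scope.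

Section ReflectingPath.
Variable R : realFieldType.

(** Arguments are field elements rather than indices, so that values at [-1] and [n] make sense and
    difference equations become rational identities for [field]. *)
Definition pinv_entry (n x y : R) : R :=
  - ((n ^+ 2 - 1) * (4%:R * n ^+ 2 - 1) / (180%:R * n))
  + (x * (x + 1) + y * (y + 1)) ^+ 2 / (24%:R * n)
  + x * (x + 1) * y * (y + 1) / (6%:R * n)
  + n / 6%:R * (x * (x + 1) + y * (y + 1))
  - (2%:R * x + 1) / 12%:R * (x * (x + 1) + 3%:R * y * (y + 1)).

Definition green_entry (n x y : R) : R :=
  (x * (x + 1) + y * (y + 1)) / (2%:R * n) + n / 3%:R + 1 / (6%:R * n)
  - (2%:R * x + 1) / 2%:R.

(** The closed forms are valid on and below the diagonal only; the other triangle is filled by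
    symmetry. *)
Definition sym_kernel (f : R -> R -> R) (j k : nat) : R :=
  if (k <= j)%N then f j%:R k%:R else f k%:R j%:R.

Lemma sym_kernelC f j k : sym_kernel f j k = sym_kernel f k j.
Proof. by rewrite /sym_kernel; case: ltngtP => // ->. Qed.

Lemma sum_ord_pick (N m : nat) (h : nat -> R) :
  \sum_(i < N) (if i == m :> nat then h i else 0) =
  if (m < N)%N then h m else 0.
Proof.
rewrite -big_mkcond; case: ltnP => [lt_mN | le_Nm].
  by rewrite (big_pred1 (Ordinal lt_mN)) // => i; rewrite /= -val_eqE.
by rewrite big_pred0 // => i; apply/negbTE; have := ltn_ord i; lia.
Qed.

(** Each diagonal entry is minus the number of neighbours on the path, so a row takes differences
    with the existing neighbours and an endpoint just loses one. *)
Lemma tridiag_mulE (N : nat) (F : nat -> nat -> R) (j k : 'I_N) : (2 <= N)%N ->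
  (tridiag R N *m \matrix_(i < N, l < N) F i l) j k =
    (if (j.+1 < N)%N then F j.+1 k - F j k else 0)
    + (if (0 < j)%N then F j.-1 k - F j k else 0).
Proof.
move=> le2N; have ltjN := ltn_ord j; rewrite mxE.
pose a : R := if (j == 0 :> nat) || (j == N.-1 :> nat) then -1 else - 2%:R.
(* The guard [0 < j] matters: for [j = 0] the index [j.-1] is again [0] and would hit the
   diagonal. *)
transitivity (\sum_(i < N)
    ((if i == j :> nat then a * F i k else 0)
     + (if i == j.+1 :> nat then F i k else 0)
     + (if (0 < j)%N then if i == j.-1 :> nat then F i k else 0 else 0))).
  apply: eq_bigr => i _; rewrite !mxE -val_eqE /= -/a eq_sym.
  case: (ltngtP (i : nat) (j : nat)) => [ltij | ltji | eqij].
  - have -> : (i == j.+1 :> nat) = false by lia.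
    have -> : (0 < j)%N by lia.
    have -> : (i == j.-1 :> nat) = (j == i.+1 :> nat) by lia.
    by rewrite orbF; case: eqP => _; rewrite ?mul1r ?mul0r !add0r.
  - have -> : (i == j.-1 :> nat) = false by lia.
    have -> : (j == i.+1 :> nat) = false by lia.
    by rewrite if_same /=; case: eqP => _; rewrite ?mul1r ?mul0r ?add0r ?addr0.
  - have -> : (i == j.+1 :> nat) = false by lia.
    case: posnP => [_|jgt0]; first by rewrite !addr0.
    by have -> : (i == j.-1 :> nat) = false; [lia | rewrite !addr0].
rewrite !big_split /= (sum_ord_pick _ _ (fun i => a * F i k)).
rewrite (sum_ord_pick _ _ (fun i => F i k)) ltjN /a.
have -> : (j == N.-1 :> nat) = ~~ (j.+1 < N)%N by lia.
case: (posnP j) => [j0 | jgt0].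
  have -> : (j.+1 < N)%N by lia.
  by rewrite big1 //= mulN1r; ring.
rewrite (sum_ord_pick _ _ (fun i => F i k)).
have -> : (j.-1 < N)%N by lia.
by case: (ltnP j.+1 N) => _ /=; ring.
Qed.

(* The hypotheses at [-1] and [N] are the reflecting boundary conditions. *)
Lemma tridiag_mul_sym_kernel (N : nat) (f h : R -> R -> R) (c : R) :
    (2 <= N)%N ->
    (forall x, f x (-1) = f x 0) ->
    (forall y, f N%:R y = f (N%:R - 1) y) ->
    (forall x y, f (x + 1) y + f (x - 1) y - 2%:R * f x y = h x y) ->
    (forall x y, f x (y + 1) + f x (y - 1) - 2%:R * f x y = h x y) ->
    (forall x, f (x + 1) x + f x (x - 1) - 2%:R * f x x = h x x + c) ->
  tridiag R N *m \matrix_(j < N, k < N) sym_kernel f j k =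
  \matrix_(j < N, k < N) (sym_kernel h j k + c *+ (j == k)).
Proof.
move=> le2N f0 fN fl fr fd; apply/matrixP => j k.
rewrite (tridiag_mulE _ (sym_kernel f)) // [RHS]mxE -val_eqE /=.
have ltjN := ltn_ord j; have ltkN := ltn_ord k.
have predE : (0 < j)%N -> (j.-1)%:R = j%:R - 1 :> R.
  by case: (j : nat) => // i _; rewrite -natr1 addrK.
(* At an end of the path the difference with the fictitious neighbour vanishes, so every row can be
   treated as a full second difference. *)
have bottom x : f x j%:R = f x (j%:R - 1) \/ (0 < j)%N.
  by case: posnP => [->|_]; [left; rewrite sub0r f0 | right].
have top y : f (j%:R + 1) y = f j%:R y \/ (j.+1 < N)%N.
  case: (ltnP j.+1 N) => [|leNj]; first by right.
  have NE : j%:R + 1 = N%:R :> R by rewrite natr1; congr _%:R; lia.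
  by left; rewrite NE fN -NE addrK.
rewrite /sym_kernel; case: (ltngtP (j : nat) (k : nat)) => [ltjk | ltkj | eqjk].
- have -> : (j.+1 < N)%N by lia.
  (* If [k = j.+1], this neighbour lies on the diagonal, where both branches agree. *)
  have -> : (if (k <= j.+1)%N then f j.+1%:R k%:R else f k%:R j.+1%:R)
            = f k%:R (j%:R + 1).
    case: ifP => [lekj|_]; last by rewrite natr1.
    by have -> : (k : nat) = j.+1; [lia | rewrite natr1].
  rewrite mulr0n addr0 -fr; case: (bottom k%:R) => [fb | jgt0].
    case: posnP => [_|jgt0]; first by rewrite -fb; ring.
    have -> : (k <= j.-1)%N = false by lia.
    by rewrite predE // -fb; ring.
  have -> : (k <= j.-1)%N = false by lia.
  by rewrite jgt0 predE //; ring.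
- have jgt0 : (0 < j)%N by lia.
  have -> : (k <= j.-1)%N by lia.
  have -> : (k <= j.+1)%N by lia.
  rewrite jgt0 predE // mulr0n addr0 -fl -natr1.
  case: (top k%:R) => [ft | ->]; last by ring.
  by case: ifP => _; rewrite ft; ring.
- rewrite -eqjk leqnSn mulr1n -fd -natr1.
  (* The first branch occurs only for [j = 0], where [j.-1 = j]. *)
  have -> : (if (j <= j.-1)%N then f j.-1%:R j%:R else f j%:R j.-1%:R)
            = f j%:R j.-1%:R.
    by case: ifP => // lejj; have -> : (j : nat) = 0%N by lia.
  case: (top j%:R) => [ft | ->]; case: (bottom j%:R) => [fb | jgt0].
  + by case: posnP => [_|jgt0]; rewrite ?predE // ft -fb; case: ifP => _; ring.
  + by rewrite jgt0 predE // ft; case: ifP => _; ring.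
  + by case: posnP => [_|jgt0]; rewrite ?predE // -fb; ring.
  + by rewrite jgt0 predE //; ring.
Qed.

(** The two triangles fit together without a jump on the diagonal, hence [c = 0]. *)
Lemma tridiag_mul_pinv (N : nat) : (2 <= N)%N ->
  tridiag R N *m \matrix_(j < N, k < N) sym_kernel (pinv_entry N%:R) j k =
  \matrix_(j < N, k < N) sym_kernel (green_entry N%:R) j k.
Proof.
move=> le2N; have n0 : N%:R != 0 :> R by rewrite pnatr_eq0; lia.
rewrite (@tridiag_mul_sym_kernel _ _ (green_entry N%:R) 0) //;
  rewrite /pinv_entry /green_entry.
- by apply/matrixP => j k; rewrite !mxE mul0rn addr0.
- by move=> x; field.
- by move=> y; field.
- by move=> x y; field.
- by move=> x y; field.
- by move=> x; field.
Qed.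

(** The quadratic terms have constant second difference [1/N]; the term [-(2x+1)/2] adds a jump [-1]
    on the diagonal, which yields the identity matrix. *)
Lemma tridiag_mul_green (N : nat) : (2 <= N)%N ->
  tridiag R N *m \matrix_(j < N, k < N) sym_kernel (green_entry N%:R) j k =
  const_mx (N%:R^-1) - 1%:M.
Proof.
move=> le2N; have n0 : N%:R != 0 :> R by rewrite pnatr_eq0; lia.
rewrite (@tridiag_mul_sym_kernel _ _ (fun _ _ => N%:R^-1) (-1)) //;
  rewrite /green_entry.
- by apply/matrixP => j k; rewrite !mxE /sym_kernel /= if_same mulNrn.
- by move=> x; field.
- by move=> y; field.
- by move=> x y; field.
- by move=> x y; field.
- by move=> x; field.
Qed.

Lemma tridiag_mul_const (N : nat) (a : R) : (2 <= N)%N ->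
  tridiag R N *m const_mx a = 0 :> 'M_N.
Proof.
move=> le2N; have -> : const_mx a = \matrix_(j < N, k < N) a by apply/matrixP => j k; rewrite !mxE.
apply/matrixP => j k; rewrite (tridiag_mulE _ (fun _ _ => a)) // mxE.
by rewrite subrr !if_same addr0.
Qed.

Lemma tr_tridiag (N : nat) : (tridiag R N)^T = tridiag R N.
Proof.
apply/matrixP => j k; rewrite !mxE.
by case: (eqVneq j k) => [-> | _]; rewrite ?eqxx // orbC.
Qed.

(* Closed forms for the partial sums of [pinv_entry] over its first, resp.
   second argument below [m]; [t] and [q] are the sums of [i * (i + 1)] and of
   its square over [i < m]. *)
Definition pinv_sum_fst (n m y : R) : R :=
  let v := y * (y + 1) in
  let t := (m ^+ 3 - m) / 3%:R in
  let q := m * (m ^+ 2 - 1) * (3%:R * m ^+ 2 - 2%:R) / 15%:R in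
  - ((n ^+ 2 - 1) * (4%:R * n ^+ 2 - 1) / (180%:R * n)) * m
  + (q + 2%:R * v * t + v ^+ 2 * m) / (24%:R * n)
  + v * t / (6%:R * n) + n / 6%:R * (t + v * m)
  - (m ^+ 2 * (m ^+ 2 - 1) / 2%:R + 3%:R * v * m ^+ 2) / 12%:R.

Definition pinv_sum_snd (n x m : R) : R :=
  let u := x * (x + 1) in
  let t := (m ^+ 3 - m) / 3%:R in
  let q := m * (m ^+ 2 - 1) * (3%:R * m ^+ 2 - 2%:R) / 15%:R in
  - ((n ^+ 2 - 1) * (4%:R * n ^+ 2 - 1) / (180%:R * n)) * m
  + (q + 2%:R * u * t + u ^+ 2 * m) / (24%:R * n)
  + u * t / (6%:R * n) + n / 6%:R * (t + u * m)
  - (2%:R * x + 1) / 12%:R * (u * m + 3%:R * t).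

(** [B P = G] fixes each column only up to a constant; the constant term of [pinv_entry] is the one
    that makes the column sums vanish. *)
Lemma sum_pinv_entry_col (N : nat) (k : 'I_N) :
  \sum_(j < N) sym_kernel (pinv_entry N%:R) j k = 0.
Proof.
have ltkN := ltn_ord k.
have n0 : N%:R != 0 :> R by rewrite pnatr_eq0; lia.
rewrite -(big_mkord xpredT (fun j => sym_kernel (pinv_entry N%:R) j k)).
(* Above the diagonal [j] is the second argument of [pinv_entry], from [k] on the first; each half
   telescopes through its closed form. *)
rewrite (@big_cat_nat _ _ _ k) //=; last exact: ltnW.
rewrite [X in X + _](eq_big_nat _ _
  (F2 := fun j => pinv_sum_snd N%:R k%:R j.+1%:R - pinv_sum_snd N%:R k%:R j%:R)).
  rewrite telescope_sumr // [X in _ + X](eq_big_nat _ _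
    (F2 := fun j => pinv_sum_fst N%:R j.+1%:R k%:R - pinv_sum_fst N%:R j%:R k%:R)).
    rewrite telescope_sumr; last exact: ltnW.
    by rewrite /pinv_sum_fst /pinv_sum_snd /=; field.
  move=> j /andP[lekj _]; rewrite /sym_kernel lekj -natr1.
  by rewrite /pinv_sum_fst /pinv_entry /=; field.
move=> j /andP[_ ltjk]; rewrite /sym_kernel leqNgt ltjk -natr1.
by rewrite /pinv_sum_snd /pinv_entry /=; field.
Qed.

End ReflectingPath.

Theorem theorem2p6 (R : realType) (N : nat) (hN : (2 <= N)%N) :
  let B : 'M[R]_N := tridiag R N in
  let L : 'M[R]_N := - (B *m B) in
  let n : R := N%:R in
  [/\ (moore_penrose L)^T = moore_penrose L,
      moore_penrose L = - moore_penrose (B *m B)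
    & forall j k : 'I_N, (k <= j)%N ->
        let x : R := (j : nat)%:R in
        let y : R := (k : nat)%:R in
        moore_penrose L j k =
          - ((n ^+ 2 - 1) * (4%:R * n ^+ 2 - 1) / (180%:R * n))
          + (x * (x + 1) + y * (y + 1)) ^+ 2 / (24%:R * n)
          + x * (x + 1) * y * (y + 1) / (6%:R * n)
          + n / 6%:R * (x * (x + 1) + y * (y + 1))
          - (2%:R * x + 1) / 12%:R * (x * (x + 1) + 3%:R * y * (y + 1))].
Proof.
move=> B L n.
pose P : 'M[R]_N := \matrix_(j < N, k < N) sym_kernel R (pinv_entry R n) j k.
pose J : 'M[R]_N := const_mx n^-1.
have trP : P^T = P by apply/matrixP => j k; rewrite !mxE sym_kernelC.
have trL : L^T = L by rewrite linearN /= trmx_mul tr_tridiag.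
have LP : L *m P = 1%:M - J.
  by rewrite mulNmx -mulmxA tridiag_mul_pinv // tridiag_mul_green // opprB.
have trLP : (L *m P)^T = L *m P.
  by rewrite LP linearB /= trmx1 trmx_const.
have PL : P *m L = 1%:M - J by rewrite -LP -trLP trmx_mul trL trP.
have LJ : L *m J = 0 by rewrite mulNmx -mulmxA tridiag_mul_const // mulmx0 oppr0.
have JP : J *m P = 0.
  apply/matrixP => j k; rewrite !mxE.
  (* Each entry of [J P] is [1/N] times a column sum of [P]. *)
  rewrite -[RHS](mulr0 n^-1) -[X in _ = _ * X](sum_pinv_entry_col R N k).
  by rewrite mulr_sumr; apply: eq_bigr => i _; rewrite !mxE.
have mpL : moore_penrose L = P.
  apply: moore_penrose_unique; apply/and4P; split; apply/eqP => //.
  - by rewrite -mulmxA PL mulmxBr mulmx1 LJ subr0.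
  - by rewrite PL mulmxBl mul1mx JP subr0.
  - by rewrite trmx_mul trL trP LP PL.
split; first by rewrite mpL.
(* Negating both a matrix and its pseudoinverse preserves the four Penrose equations. *)
- apply: moore_penrose_unique.
  have /and4P[/eqP h1 /eqP h2 /eqP h3 /eqP h4] := moore_penroseP (B *m B).
  by apply/and4P; split; apply/eqP; rewrite /L !(mulNmx, mulmxN, opprK) ?h1 ?h2 ?h3 ?h4.
- by move=> j k lekj x y; rewrite mpL mxE /sym_kernel lekj.
Qed.
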